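(* Consider an LP solver which, among all optimal extreme point solutions of a node LP, reports one with a maximal number of fractional components. For a vertex cover instance $\mathcal{I}$, let $\mathcal{T}_S(\mathcal{I})$ and $\mathcal{T}_G(\mathcal{I})$ be any branch-and-bound trees solving $\mathcal{I}$ (with this LP solver and worst-bound node selection) obtained using the strong-branching rule (product score) and the greedy rule, respectively. Then there is a family of vertex cover instances $\mathcal{I}^*$ on $n$ vertices (with $n\to\infty$) such that $$|\mathcal{T}_G(\mathcal{I}^* )|\ge 2^{\Omega(n)}\cdot|\mathcal{T}_S(\mathcal{I}^* )| \quad\text{and}\quad |\mathcal{T}_G(\mathcal{I}^* )|\ge 2^{c\cdot\Gamma(\mathcal{I}^* )}$$ for some constant $c>2$.
   Context: Vertex cover IP for a graph $G=(V,E)$, $n=|V|$: minimize $\sum_v x_v$ subject to $x_u+x_v\ge1$ ($uv\in E$), $x\in\{0,1\}^V$; LP relaxation uses $x\in[0,1]^V$; $\Gamma(\mathcal{I})$ is the IP optimal value minus the LP optimal value. Branch-and-bound: nodes are the LP relaxation plus fixings $x_j\in\{0\}$ or $\{1\}$; a node is pruned if infeasible, if the returned solution is integral, or if its LP value is strictly larger than that of an integral solution already found; worst-bound node selection processes an open node of smallest LP value; $|\mathcal{T}|$ is the number of nodes. Strong branching with product score: at node $N$ with LP value $z$ and returned solution $\hat x$, for each $j$ with $\hat x_j$ fractional compute children's LP values $z^0_j,z^1_j$ ($+\infty$ if infeasible), $\Delta^-_j=z^0_j-z$, $\Delta^+_j=z^1_j-z$, and branch on a maximizer of $\Delta^+_j\Delta^-_j$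 (with $0\cdot\infty=0$). Greedy rule: branch on a vertex $v$ with $\hat x_v$ fractional having the largest number of neighbours $u$ with $\hat x_u$ fractional. *)

(* Defs.v *)
From Stdlib Require Import Reals.
From Stdlib Require List.
From mathcomp Require Import all_boot all_order all_algebra.
From mathcomp Require Import Rstruct.
Set Implicit Arguments. Unset Strict Implicit. Unset Printing Implicit Defensive.
Import Order.TTheory GRing.Theory Num.Theory.
Local Open Scope ring_scope.

Definition simple_graph (n : nat) (E : rel 'I_n) : Prop :=
  (forall u v, E u v = E v u) /\ (forall u, E u u = false).

(* A node of the branch-and-bound tree: a set of fixings x_j = b. *)
Definition fixing (n : nat) := 'I_n -> option bool.
Definition root_fix (n : nat) : fixing n := fun _ => None.
Definition setfix (n : nat) (f : fixing n) (j : 'I_n) (b : bool) : fixing n :=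
  fun i => if i == j then Some b else f i.

(* Extended reals for LP values: None = +oo (infeasible LP). *)
Definition ext := option R.
Definition ext_le (a b : ext) : Prop :=
  match a, b with
  | _, None => True
  | None, Some _ => False
  | Some x, Some y => x <= y
  end.
Definition ext_lt (a b : ext) : Prop := ext_le a b /\ a <> b.
Definition ext_min (a b : ext) : ext :=
  match a, b with
  | None, _ => b
  | _, None => a
  | Some x, Some y => Some (Num.min x y)
  end.
Definition ext_subr (a : ext) (z : R) : ext :=
  match a with None => None | Some x => Some (x - z) end.
(* product on [0, +oo] with the convention 0 * oo = 0 *)
Definition ext_mul (a b : ext) : ext :=
  match a, b with
  | Some x, Some y => Some (x * y)
  | None, Some y => if y == 0 then Some 0 else None
  | Some x, None => if x == 0 then Some 0 else None
  | None, None => None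
  end.

Definition obj (n : nat) (x : 'I_n -> R) : R := \sum_(i < n) x i.

Definition lp_feasible (n : nat) (E : rel 'I_n) (f : fixing n) (x : 'I_n -> R) : Prop :=
  (forall i, 0 <= x i <= 1) /\
  (forall u v, E u v -> 1 <= x u + x v) /\
  (forall i b, f i = Some b -> x i = (if b then 1 else 0)).

Definition lp_val (n : nat) (E : rel 'I_n) (f : fixing n) (v : ext) : Prop :=
  match v with
  | None => forall x, ~ lp_feasible E f x
  | Some z => (exists x, lp_feasible E f x /\ obj x = z) /\
              (forall x, lp_feasible E f x -> z <= obj x)
  end.

Definition integral (n : nat) (x : 'I_n -> R) : Prop :=
  forall i, x i = 0 \/ x i = 1.

Definition ip_val (n : nat) (E : rel 'I_n) (z : R) : Prop :=
  (exists x, lp_feasible E (@root_fix n) x /\ integral x /\ obj x = z) /\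
  (forall x, lp_feasible E (@root_fix n) x -> integral x -> z <= obj x).

Definition gap (n : nat) (E : rel 'I_n) (g : R) : Prop :=
  exists zip zlp, ip_val E zip /\ lp_val E (@root_fix n) (Some zlp) /\ g = zip - zlp.

Definition lp_optimal (n : nat) (E : rel 'I_n) (f : fixing n) (x : 'I_n -> R) : Prop :=
  lp_feasible E f x /\ forall y, lp_feasible E f y -> obj x <= obj y.

Definition extreme (n : nat) (E : rel 'I_n) (f : fixing n) (x : 'I_n -> R) : Prop :=
  lp_feasible E f x /\
  forall (y w : 'I_n -> R) (l : R), lp_feasible E f y -> lp_feasible E f w ->
    0 < l < 1 -> (forall i, x i = l * y i + (1 - l) * w i) -> (forall i, y i = w i).

Definition frac (n : nat) (x : 'I_n -> R) (i : 'I_n) : bool :=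
  (x i != 0) && (x i != 1).
Definition nfrac (n : nat) (x : 'I_n -> R) : nat := #|[pred i | frac x i]|.

(* The LP solver: an optimal extreme point with a maximal number of
   fractional components (nondeterministic among ties). *)
Definition solver_output (n : nat) (E : rel 'I_n) (f : fixing n) (x : 'I_n -> R) : Prop :=
  lp_optimal E f x /\ extreme E f x /\
  forall y, lp_optimal E f y -> extreme E f y -> (nfrac y <= nfrac x)%N.

(* A branching rule: rule E f x j means "at node f with reported solution x,
   the rule may branch on x_j". *)
Definition branching_rule := forall n : nat, rel 'I_n -> fixing n -> ('I_n -> R) -> 'I_n -> Prop.

Definition sb_score (n : nat) (E : rel 'I_n) (f : fixing n) (z : R) (j : 'I_n) (s : ext) : Prop :=
  exists v0 v1, lp_val E (setfix f j false) v0 /\ lp_val E (setfix f j true) v1 /\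
    s = ext_mul (ext_subr v0 z) (ext_subr v1 z).

Definition strong_branching : branching_rule :=
  fun n E f x j =>
    frac x j /\
    exists sj, sb_score E f (obj x) j sj /\
      forall k sk, frac x k -> sb_score E f (obj x) k sk -> ext_le sk sj.

Definition nfrac_nbrs (n : nat) (E : rel 'I_n) (x : 'I_n -> R) (v : 'I_n) : nat :=
  #|[pred u | E v u && frac x u]|.

Definition greedy_rule : branching_rule :=
  fun n E f x j =>
    frac x j /\ forall k, frac x k -> (nfrac_nbrs E x k <= nfrac_nbrs E x j)%N.

(* State of a branch-and-bound run: open nodes, incumbent value
   (None = no integral solution found yet), number of nodes created. *)
Definition bb_state (n : nat) := (seq (fixing n) * ext * nat)%type.

Inductive bb_step (rule : branching_rule) (n : nat) (E : rel 'I_n) :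
    bb_state n -> bb_state n -> Prop :=
  | bb_prune_infeas pre N post inc cnt :
      (forall M v, List.In M (pre ++ post) -> lp_val E M v -> ext_le None v) ->
      lp_val E N None ->
      bb_step rule E (pre ++ N :: post, inc, cnt) (pre ++ post, inc, cnt)
  | bb_prune_integral pre N post inc cnt z x :
      lp_val E N (Some z) ->
      (forall M v, List.In M (pre ++ post) -> lp_val E M v -> ext_le (Some z) v) ->
      solver_output E N x -> integral x ->
      bb_step rule E (pre ++ N :: post, inc, cnt) (pre ++ post, ext_min inc (Some z), cnt)
  | bb_prune_bound pre N post inc cnt z x :
      lp_val E N (Some z) ->
      (forall M v, List.In M (pre ++ post) -> lp_val E M v -> ext_le (Some z) v) ->
      solver_output E N x -> ~ integral x -> ext_lt inc (Some z) ->
      bb_step rule E (pre ++ N :: post, inc, cnt) (pre ++ post, inc, cnt)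
  | bb_branch pre N post inc cnt z x j :
      lp_val E N (Some z) ->
      (forall M v, List.In M (pre ++ post) -> lp_val E M v -> ext_le (Some z) v) ->
      solver_output E N x -> ~ integral x -> ~ ext_lt inc (Some z) ->
      rule n E N x j ->
      bb_step rule E (pre ++ N :: post, inc, cnt)
                     (setfix N j false :: setfix N j true :: pre ++ post, inc, cnt.+2).

Inductive bb_reach (rule : branching_rule) (n : nat) (E : rel 'I_n) :
    bb_state n -> bb_state n -> Prop :=
  | bb_refl s : bb_reach rule E s s
  | bb_trans s1 s2 s3 : bb_step rule E s1 s2 -> bb_reach rule E s2 s3 -> bb_reach rule E s1 s3.

Definition bb_tree_size (rule : branching_rule) (n : nat) (E : rel 'I_n) (t : nat) : Prop :=
  exists inc, bb_reach rule E ([:: @root_fix n], None, 1%N) ([::], inc, t).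

(* Main.v *)
Require Import Defs.
From Stdlib Require Import Reals.
From mathcomp Require Import all_boot all_order all_algebra.
From mathcomp Require Import Rstruct.
From mathcomp Require Import lra zify.
(* Imported again because [frac] would otherwise denote mathcomp's fractions. *)
Import Defs.
Set Implicit Arguments. Unset Strict Implicit. Unset Printing Implicit Defensive.
Import Order.TTheory GRing.Theory Num.Theory.
Local Open Scope ring_scope.

(** The instance is the disjoint union of [k] copies of a 9-vertex gadget: a tree with
    a perfect matching whose hub has degree 3, and a triangle one of whose vertices is
    joined to the hub. One gadget has LP value 9/2 and IP value 5, and the solver
    reports all of its vertices fractional. The hub is the unique vertex of degree 4,
    so the greedy rule branches on it: fixing it to 0 forces a triangle vertex to 1 and
    solves the gadget, but fixing it to 1 leaves the triangle untouched, which then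
    costs another branching; hence 1 + 2 leaves per gadget. A tree vertex has score 0
    because one of its two fixings keeps the LP value, whereas both fixings of a
    triangle vertex raise it by 1/2, so strong branching takes a triangle vertex; what
    remains of the gadget is bipartite, hence integral, giving 2 leaves per gadget.
    No node has LP value above the IP value, so nothing is pruned by bound and the
    trees have exactly [2 * 3 ^ k - 1] and [2 * 2 ^ k - 1] nodes, with gap [k / 2]. *)

(** * Node LPs and their extreme points, for arbitrary graphs *)

Lemma lp_val_uniq (n : nat) (E : rel 'I_n) f v w :
  lp_val E f v -> lp_val E f w -> v = w.
Proof.
case: v w => [a|] [b|] //=.
- move=> [[x [fx <-]] mx] [[y [fy <-]] my]; congr Some.
  by apply/le_anti; rewrite mx // my.
- by move=> [[x [fx _]] _] /(_ x).
- by move=> nf [[x [fx _]] _]; case: (nf x).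
Qed.

(* Shifting the fractional vertices of S by +eps on one colour class and by -eps
   on the other keeps every edge constraint, so an extreme point has none. *)
Lemma extreme_bicolored_integral (n : nat) (E : rel 'I_n) f x (S col : pred 'I_n) :
  extreme E f x ->
  (forall u v, E u v -> frac x u -> frac x v -> S u -> S v /\ col u != col v) ->
  (forall u v, E u v = E v u) ->
  forall u, S u -> ~~ frac x u.
Proof.
move=> [[x01 [xE xf]] xext] bic Esym u0 Su0; apply/negP => fu0.
have fracP i : frac x i -> 0 < x i < 1.
  by move=> /andP[n0 n1]; have := x01 i; rewrite !lt_neqAle eq_sym n0 n1.
(* The shift [e] is the smallest distance from a fractional coordinate to 0 or 1, so moving
   fractional coordinates by it stays within the bounds. *)
pose m i := Num.min (x i) (1 - x i).
have [i1 fi1 mi1] : exists2 i1, frac x i1 & forall i, frac x i -> m i1 <= m i.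
  by case: (arg_minP m fu0) => i fi mi; exists i.
pose e := m i1.
have e0 : 0 < e by rewrite /e /m lt_min subr_gt0; apply: fracP.
have eP i : frac x i -> e <= x i /\ x i <= 1 - e.
  move=> /mi1; rewrite -/e /m le_min => /andP[h1 h2]; split=> //; lra.
pose D (s : R) i : R := if S i && frac x i then (if col i then s else - s) else 0.
have feas s : s = e \/ s = - e -> lp_feasible E f (fun i => x i + D s i).
  move=> hs; split; [|split].
  - move=> i; rewrite /D; case: ifP => [/andP[_ fi]|_]; last first.
      by rewrite addr0; apply: x01.
    have [] := eP _ fi; have := fracP _ fi.
    by case: hs => ->; case: (col i) => *; apply/andP; split; lra.
  - move=> u v Euv.
    have h u' v' : E u' v' -> S u' -> frac x u' -> 1 <= x u' + D s u' + (x v' + D s v').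
      move=> Euv' Su fu; have fu' := fracP _ fu; have [eu1 eu2] := eP _ fu.
      have xe := xE _ _ Euv'.
      case fv : (frac x v').
        have [Sv] := bic _ _ Euv' fu fv Su.
        rewrite /D Su Sv fu fv /=; case: (col u'); case: (col v') => // _; lra.
      rewrite /D Su fu fv andbF /=.
      (* An integral neighbour of a fractional vertex must be 1, so it covers the edge by itself,
         whatever the shift. *)
      move/negbT: fv; rewrite /frac negb_and !negbK => /orP[] /eqP xv.
        by move: xe fu'; rewrite xv => *; lra.
      by rewrite xv; case: hs => ->; case: (col u') => *; lra.
    case Su : (S u && frac x u); first by move/andP: Su => [? ?]; apply: h.
    case Sv : (S v && frac x v).
      by move/andP: Sv => [? ?]; rewrite addrC; apply: h; rewrite // Esym.
    by rewrite /D Su Sv !addr0; apply: xE.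
  - move=> i b fi; rewrite -(xf _ _ fi) /D.
    case: ifP => [/andP[_]|]; last by rewrite addr0.
    by rewrite /frac (xf _ _ fi); case: (b); rewrite eqxx ?andbF.
have := xext _ _ (1 / 2) (feas e (or_introl erefl)) (feas (- e) (or_intror erefl)).
have h12 : 0 < ((1 / 2)%R : R) < 1 by apply/andP; split; lra.
move=> /(_ h12) h.
have /h : forall i, x i = 1 / 2 * (x i + D e i) + (1 - 1 / 2) * (x i + D (- e) i).
  by move=> i; rewrite /D; case: ifP => _; [case: (col i)|]; lra.
by move=> /(_ u0); rewrite /D Su0 fu0 /=; case: (col u0) => *; lra.
Qed.

(** * The gadget and its disjoint unions *)

(* Vertex 0 is the hub, 1-5 the rest of the tree, matched by 01, 24 and 35, and 6-8 the
   triangle. *)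
Definition gadget_adj (p q : nat) : bool :=
  let edges := [:: (0, 1); (0, 2); (0, 3); (0, 6); (2, 4); (3, 5);
                   (6, 7); (6, 8); (7, 8)]%N in
  ((p, q) \in edges) || ((q, p) \in edges).

(** Vertices are pairs of a gadget and a position in it; [enum_val] and [enum_rank] translate
    between such pairs and the ordinals on which graphs are defined. *)
Definition nvert (k : nat) : nat := #|{: 'I_k * 'I_9}|.

Section GadgetUnion.
Variable k : nat.
Implicit Types (f : fixing (nvert k)) (x y : 'I_(nvert k) -> R).

Definition gad (u : 'I_(nvert k)) : 'I_k := (enum_val u).1.
Definition pos (u : 'I_(nvert k)) : 'I_9 := (enum_val u).2.
(** Positions are plain numbers, so that concrete vertices can be named by numerals and case
    analysis computes; only [p < 9] is meaningful. *)
Definition vx (g : 'I_k) (p : nat) : 'I_(nvert k) := enum_rank (g, inord p : 'I_9).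
Definition gadgets : rel 'I_(nvert k) :=
  fun u v => (gad u == gad v) && gadget_adj (pos u) (pos v).

Lemma gad_vx g p : gad (vx g p) = g. Proof. by rewrite /gad enum_rankK. Qed.
Lemma pos_vx g p : (p < 9)%N -> pos (vx g p) = p :> nat.
Proof. by move=> lp; rewrite /pos enum_rankK /= inordK. Qed.
Lemma vxK u : vx (gad u) (pos u) = u.
Proof. by rewrite /vx inord_val -surjective_pairing enum_valK. Qed.

Lemma vxP u : exists g p, (p < 9)%N /\ u = vx g p.
Proof. by exists (gad u), (pos u); rewrite vxK. Qed.

Lemma vx_eq g h p q : (p < 9)%N -> (q < 9)%N -> (vx g p == vx h q) = (g == h) && (p == q).
Proof.
move=> lp lq; apply/eqP/andP => [e|[/eqP-> /eqP->] //].
by split; [rewrite -(gad_vx g p) e gad_vx|rewrite -(pos_vx g lp) e pos_vx].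
Qed.

Lemma gadgetsE g h p q : (p < 9)%N -> (q < 9)%N ->
  gadgets (vx g p) (vx h q) = (g == h) && gadget_adj p q.
Proof. by move=> lp lq; rewrite /gadgets !gad_vx !pos_vx. Qed.

Lemma gadgets_sym u v : gadgets u v = gadgets v u.
Proof. by rewrite /gadgets eq_sym /gadget_adj orbC. Qed.

Lemma gadgets_simple : simple_graph gadgets.
Proof.
split; first exact: gadgets_sym.
by move=> u; rewrite /gadgets eqxx /=; case: (pos u) => p lp; move: p lp; do 9?[case=> //].
Qed.

Definition gsum x g : R :=
  (x (vx g 0) + x (vx g 1) + x (vx g 2) + x (vx g 3) + x (vx g 4) + x (vx g 5)
   + x (vx g 6) + x (vx g 7) + x (vx g 8))%R.

Lemma big_vx (T : Type) (idx : T) (op : Monoid.com_law idx) (F : 'I_(nvert k) -> T) :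
  \big[op/idx]_u F u = \big[op/idx]_(g < k) \big[op/idx]_(p < 9) F (vx g p).
Proof.
rewrite (reindex (fun c : 'I_k * 'I_9 => enum_rank c)) /=; last first.
  by exists enum_val => c _; rewrite (enum_rankK, enum_valK).
rewrite pair_big; apply: eq_bigr => -[g p] _.
by rewrite /vx inord_val.
Qed.

Lemma objE x : obj x = \sum_g gsum x g.
Proof.
rewrite /obj big_vx; apply: eq_bigr => g _.
by rewrite !big_ord_recr big_ord0 /= add0r.
Qed.

(** * The node LP gadget by gadget, with lower bounds *)

Definition feasible_at f x g :=
  [/\ forall p, (p < 9)%N -> 0 <= x (vx g p) <= 1,
      forall p q, (p < 9)%N -> (q < 9)%N -> gadget_adj p q -> 1 <= x (vx g p) + x (vx g q)
    & forall p b, (p < 9)%N -> f (vx g p) = Some b -> x (vx g p) = (if b then 1 else 0)].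

(** No edge joins two gadgets, so the constraints separate. *)
Lemma lp_feasibleE f x : lp_feasible gadgets f x <-> forall g, feasible_at f x g.
Proof.
split=> [[x01 [xE xf]] g|h].
  split=> // [p q lp lq a|p b lp]; last exact: xf.
  by apply: xE; rewrite gadgetsE ?eqxx.
split; [|split].
- by move=> u; have [g [p [lp ->]]] := vxP u; have [+ _ _] := h g; apply.
- move=> u v; have [g [p [lp ->]]] := vxP u; have [g' [q [lq ->]]] := vxP v.
  by rewrite gadgetsE // => /andP[/eqP-> a]; have [_ + _] := h g'; apply.
- by move=> u b; have [g [p [lp ->]]] := vxP u; have [_ _] := h g; apply.
Qed.

Definition hub_is f g (o : option bool) : bool := f (vx g 0) == o.
Definition tri_free f g : bool :=
  [&& f (vx g 6) == None, f (vx g 7) == None & f (vx g 8) == None].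
(** The fixings that force an integral triangle vertex in every feasible solution, and with it the
    value 5 on the gadget. *)
Definition solved f g : bool := hub_is f g (Some false) || ~~ tri_free f g.

Lemma feasible_edges f x g : feasible_at f x g ->
  [/\ 1 <= x (vx g 0) + x (vx g 1), 1 <= x (vx g 2) + x (vx g 4),
      1 <= x (vx g 3) + x (vx g 5), 1 <= x (vx g 0) + x (vx g 6) &
      [/\ 1 <= x (vx g 6) + x (vx g 7), 1 <= x (vx g 6) + x (vx g 8)
        & 1 <= x (vx g 7) + x (vx g 8)]].
Proof. by case=> _ xe _; split; [..|split]; apply: xe. Qed.

(** The matching edges 01, 24, 35 weigh at least 1 each, and half the sum of the three triangle
    edges gives 3/2. *)
Lemma gsum_ge f x g : feasible_at f x g -> 9 / 2 <= gsum x g.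
Proof. by case/feasible_edges => ? ? ? ? [? ? ?]; rewrite /gsum; lra. Qed.

(** A triangle vertex at 1 leaves the opposite edge to be covered, and one at 0 forces both others
    to 1; either way the triangle weighs at least 2, and the matching adds 3. *)
Lemma gsum_ge_tri f x g : feasible_at f x g ->
  ~~ [&& frac x (vx g 6), frac x (vx g 7) & frac x (vx g 8)] -> 5 <= gsum x g.
Proof.
move=> fx; case: (fx) => x01 _ _; case/feasible_edges: fx => ? ? ? ? [? ? ?].
have := x01 6%N isT; have := x01 7%N isT; have := x01 8%N isT.
rewrite /gsum /frac => /andP[? ?] /andP[? ?] /andP[? ?].
by rewrite !negb_and !negbK => /or3P[] /orP[]; rewrite eq_le => /andP[? ?]; lra.
Qed.

(** A hub at 0 forces vertex 6 to 1 through the edge 06; a fixed triangle vertex is integral by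
    itself. *)
Lemma solved_tri f x g : feasible_at f x g -> solved f g ->
  ~~ [&& frac x (vx g 6), frac x (vx g 7) & frac x (vx g 8)].
Proof.
move=> fx; case: (fx) => x01 _ xf; case/feasible_edges: fx => _ _ _ e06 _.
have nf p : (p < 9)%N -> f (vx g p) != None -> ~~ frac x (vx g p).
  move=> lp; case e : (f (vx g p)) => [b|] // _; rewrite /frac (xf p b lp e).
  by case: b {e}; rewrite eqxx ?andbF.
rewrite /solved /hub_is => sol; apply/negP => /and3P[F6 F7 F8].
case/orP: sol => [/eqP h|].
  move: e06 (x01 6%N isT); rewrite (xf 0%N false isT h) add0r => h1 /andP[_ h2].
  have x6 : x (vx g 6) = 1 by apply/le_anti; rewrite h1 h2.
  by move: F6; rewrite /frac x6 eqxx andbF.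
rewrite /tri_free !negb_and => /or3P[] /nf => /(_ isT); by rewrite ?F6 ?F7 ?F8.
Qed.

Definition gval f g : R := (if solved f g then 5 else 9 / 2)%R.

Lemma gsum_ge_gval f x g : feasible_at f x g -> gval f g <= gsum x g.
Proof.
move=> fx; rewrite /gval; case: ifP => [s|_]; last exact: gsum_ge fx.
exact: gsum_ge_tri fx (solved_tri fx s).
Qed.

(** * Tree nodes and an explicit optimal solution at each *)

(* A gadget in a tree: only the hub and at most one triangle vertex are fixed,
   and nothing else once the hub is fixed to 0. *)
Definition reachable_vals (h t6 t7 t8 : option bool) : bool :=
  (count isSome [:: t6; t7; t8] <= (h != Some false))%N.

Definition reachable_at f g : bool :=
  all (fun p => f (vx g p) == None) (iota 1 5) &&
  reachable_vals (f (vx g 0)) (f (vx g 6)) (f (vx g 7)) (f (vx g 8)).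

(* An optimal solution, in units of 1/2. *)
Definition sample_vals (h t6 t7 t8 : option bool) : seq nat :=
  if h == Some false then [:: 0; 2; 2; 2; 0; 0; 2; 2; 0]%N
  else match t6, t7, t8 with
  | None, None, None => if h == None then nseq 9 1%N else [:: 2; 0; 0; 0; 2; 2; 1; 1; 1]%N
  | Some false, _, _ => [:: 2; 0; 0; 0; 2; 2; 0; 2; 2]%N
  | _, Some false, _ | _, _, Some true => [:: 2; 0; 0; 0; 2; 2; 2; 0; 2]%N
  | _, _, _ => [:: 2; 0; 0; 0; 2; 2; 2; 2; 0]%N
  end.

Definition sample_at f g : seq nat :=
  sample_vals (f (vx g 0)) (f (vx g 6)) (f (vx g 7)) (f (vx g 8)).

Definition sample f : 'I_(nvert k) -> R :=
  fun u => ((nth 0%N (sample_at f (gad u)) (pos u))%:R / 2)%R.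

Lemma sampleE f g p : (p < 9)%N -> sample f (vx g p) = (nth 0%N (sample_at f g) p)%:R / 2.
Proof. by move=> lp; rewrite /sample gad_vx pos_vx. Qed.

(** Bounds, edges, half-integral support, value and fixings depend only on the four fixings that can
    occur, so all 81 cases are checked by computation. *)
Lemma sample_vals_spec h t6 t7 t8 : reachable_vals h t6 t7 t8 ->
  let s := sample_vals h t6 t7 t8 in
  let unsolved := [&& h != Some false, t6 == None, t7 == None & t8 == None] in
  [/\ all (fun p => nth 0%N s p <= 2)%N (iota 0 9),
      all (fun p => all (fun q => gadget_adj p q ==> (2 <= nth 0%N s p + nth 0%N s q)%N)
                        (iota 0 9)) (iota 0 9),
      all (fun p => (nth 0%N s p == 1%N) == (unsolved && ((h == None) || (6 <= p)%N)))
          (iota 0 9),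
      sumn s = (if unsolved then 9 else 10)%N &
      all (fun pt => if pt.2 is Some b then nth 0%N s pt.1 == (nat_of_bool b).*2 else true)
          [:: (0, h); (6, t6); (7, t7); (8, t8)]%N].
Proof. by case: h t6 t7 t8 => [[]|] [[]|] [[]|] [[]|]. Qed.

Lemma all_iota9 (P : pred nat) p : all P (iota 0 9) -> (p < 9)%N -> P p.
Proof. by move=> /allP h lp; apply: h; rewrite mem_iota. Qed.

Lemma sample_feasible_at f g : reachable_at f g -> feasible_at f (sample f) g.
Proof.
move=> /andP[lf] /sample_vals_spec[]; rewrite -/(sample_at f g) => s2 sE _ _ sf.
split=> [p lp|p q lp lq a|p b lp fp].
- rewrite sampleE //; have := all_iota9 s2 lp; rewrite -(ler_nat R) => h2.
  by have := ler0n R (nth 0%N (sample_at f g) p) => h0; apply/andP; split; lra.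
- rewrite !sampleE //; have /implyP/(_ a) := all_iota9 (all_iota9 sE lp) lq.
  by rewrite -(ler_nat R) natrD => ?; lra.
- have sp : nth 0%N (sample_at f g) p = b.*2.
    move: lp fp sf; case/and5P: lf => /eqP f1 /eqP f2 /eqP f3 /eqP f4 /andP[/eqP f5 _].
    case: p => [|[|[|[|[|[|[|[|[|//]]]]]]]]] _; rewrite ?f1 ?f2 ?f3 ?f4 ?f5 // => fp /=;
      rewrite fp; by case/and5P => // *; apply/eqP.
  by rewrite sampleE // sp; case: (b); rewrite ?mul0r ?divff // pnatr_eq0.
Qed.

Lemma solvedN f g : ~~ solved f g =
  [&& f (vx g 0) != Some false, f (vx g 6) == None, f (vx g 7) == None & f (vx g 8) == None].
Proof. by rewrite /solved negb_or negbK. Qed.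

(* The fractional vertices of every solver output at f. *)
Definition active f (u : 'I_(nvert k)) : bool :=
  ~~ solved f (gad u) && (hub_is f (gad u) None || (6 <= pos u)%N).

Lemma activeE f g p : (p < 9)%N ->
  active f (vx g p) = ~~ solved f g && (hub_is f g None || (6 <= p)%N).
Proof. by move=> lp; rewrite /active gad_vx pos_vx. Qed.

Lemma halves_frac (m : nat) (c : R) : c = m%:R / 2 -> (m <= 2)%N ->
  (c != 0) && (c != 1) = (m == 1%N).
Proof.
move=> ->; case: m => [|[|[|//]]] _.
- by rewrite mul0r eqxx.
- by apply/andP; split; apply/eqP => h; lra.
- by rewrite divff ?eqxx ?andbF // pnatr_eq0.
Qed.

Lemma frac_sample f g p : reachable_at f g -> (p < 9)%N ->
  frac (sample f) (vx g p) = active f (vx g p).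
Proof.
move=> /andP[_] /sample_vals_spec[]; rewrite -/(sample_at f g) => s2 _ sfr _ _ lp.
rewrite activeE // solvedN -(eqP (all_iota9 sfr lp)).
by apply: halves_frac; [apply: sampleE|apply: (all_iota9 s2)].
Qed.

Lemma gsum_sample f g : reachable_at f g -> gsum (sample f) g = gval f g.
Proof.
move=> /andP[_] /sample_vals_spec[]; rewrite -/(sample_at f g) -solvedN => _ _ _ ss _.
have sz : size (sample_at f g) = 9%N.
  rewrite /sample_at /sample_vals.
  by move: (f _) (f _) (f _) (f _) => [[]|] [[]|] [[]|] [[]|].
have : gsum (sample f) g = (sumn (sample_at f g))%:R / 2.
  rewrite /gsum !sampleE //.
  case: (sample_at f g) sz => [|s0 [|s1 [|s2 [|s3 [|s4 [|s5 [|s6 [|s7 [|s8 []]]]]]]]]] // _.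
  by rewrite /= !natrD; lra.
by rewrite ss /gval if_neg => ->; case: ifP => _; lra.
Qed.

Definition reachable f : Prop := forall g, reachable_at f g.
Definition node_val f : R := \sum_g gval f g.

Lemma sample_feasible f : reachable f -> lp_feasible gadgets f (sample f).
Proof. by move=> rf; apply/lp_feasibleE => g; apply: sample_feasible_at. Qed.

Lemma obj_sample f : reachable f -> obj (sample f) = node_val f.
Proof. by move=> rf; rewrite objE; apply: eq_bigr => g _; apply: gsum_sample. Qed.

Lemma obj_ge_node_val f x : lp_feasible gadgets f x -> node_val f <= obj x.
Proof.
by move=> /lp_feasibleE fx; rewrite objE; apply: ler_sum => g _; apply: gsum_ge_gval.
Qed.

Lemma node_valP f : reachable f -> lp_val gadgets f (Some (node_val f)).
Proof.
move=> rf; split; last exact: obj_ge_node_val.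
by exists (sample f); split; [apply: sample_feasible|apply: obj_sample].
Qed.

Lemma sample_optimal f : reachable f -> lp_optimal gadgets f (sample f).
Proof.
move=> rf; split; first exact: sample_feasible.
by move=> y fy; rewrite obj_sample //; apply: obj_ge_node_val.
Qed.

(** * Extreme points and the support of the reported solution *)

Lemma convex_tight_ge (l a b c : R) : 0 < l < 1 -> c <= a -> c <= b ->
  c = l * a + (1 - l) * b -> a = c /\ b = c.
Proof.
move=> /andP[l0 l1] ca cb e.
have h1 : 0 <= l * (a - c) by apply: mulr_ge0; lra.
have h2 : 0 <= (1 - l) * (b - c) by apply: mulr_ge0; lra.
have e1 : l * (a - c) = 0 by lra.
have e2 : (1 - l) * (b - c) = 0 by lra.
split; apply/eqP; rewrite -subr_eq0.
  by move/eqP: e1; rewrite mulf_eq0 => /orP[/eqP ? |//]; lra.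
by move/eqP: e2; rewrite mulf_eq0 => /orP[/eqP ? |//]; lra.
Qed.

Lemma convex_tight_le (l a b c : R) : 0 < l < 1 -> a <= c -> b <= c ->
  c = l * a + (1 - l) * b -> a = c /\ b = c.
Proof.
move=> l01 ac bc e; have [||| h1 h2] := @convex_tight_ge l (- a)%R (- b)%R (- c)%R l01; lra.
Qed.

(** Constraints tight at the sample are tight at both ends of any segment through it. Integral
    coordinates are tight bounds. Active vertices have value 1/2, so edges between them are tight;
    the triangle, an odd cycle, then forces 1/2 on itself, and the edge 06 and the tree edges carry
    this value to the other active vertices. *)
Lemma sample_extreme f : reachable f -> extreme gadgets f (sample f).
Proof.
move=> rf; split; first exact: sample_feasible.
move=> y w l fy fw l01 xyw u; have [g [p [lp ->]]] := vxP u.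
move/lp_feasibleE/(_ g): fy => fy; move/lp_feasibleE/(_ g): fw => fw.
have nfr q : (q < 9)%N -> ~~ frac (sample f) (vx g q) -> y (vx g q) = w (vx g q).
  move=> lq; have := xyw (vx g q).
  have [/(_ q lq)/andP[y0 y1] _ _] := fy; have [/(_ q lq)/andP[w0 w1] _ _] := fw.
  rewrite /frac negb_and !negbK => e /orP[] /eqP h; rewrite h in e.
    by have [-> ->] := convex_tight_ge l01 y0 w0 e.
  by have [-> ->] := convex_tight_le l01 y1 w1 e.
case act : (active f (vx g p)); last by apply: nfr; rewrite // frac_sample ?act.
have [us _] := andP act; rewrite gad_vx in us.
have sm q : (q < 9)%N -> active f (vx g q) -> sample f (vx g q) = 1 / 2.
  move=> lq aq; have := frac_sample (rf g) lq; rewrite aq /frac.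
  rewrite (halves_frac (sampleE f g lq)) => [/eqP e|]; first by rewrite sampleE // e.
  have /andP[_ /sample_vals_spec[s2 _ _ _ _]] := rf g.
  exact: all_iota9 s2 lq.
have tight q r : (q < 9)%N -> (r < 9)%N -> gadget_adj q r -> active f (vx g q) ->
    active f (vx g r) -> y (vx g q) + y (vx g r) = 1 /\ w (vx g q) + w (vx g r) = 1.
  move=> lq lr a aq ar; apply: (convex_tight_ge l01).
  - by have [_ + _] := fy; apply.
  - by have [_ + _] := fw; apply.
  - have := xyw (vx g q); have := xyw (vx g r).
    by rewrite !sm // => h1 h2; lra.
have a6 : active f (vx g 6) by rewrite activeE // us orbT.
have a7 : active f (vx g 7) by rewrite activeE // us orbT.
have a8 : active f (vx g 8) by rewrite activeE // us orbT.
have [y67 w67] := tight 6%N 7%N isT isT isT a6 a7.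
have [y68 w68] := tight 6%N 8%N isT isT isT a6 a8.
have [y78 w78] := tight 7%N 8%N isT isT isT a7 a8.
(* With the hub fixed to 1, only the triangle is active. *)
case h : (hub_is f g None); last first.
  by move: lp act; rewrite /active gad_vx us h /= => lp; rewrite pos_vx //;
     case: p lp => [|[|[|[|[|[|[|[|[|//]]]]]]]]] // _ _; lra.
have a q : (q < 9)%N -> active f (vx g q) by move=> lq; rewrite activeE // us h.
have [y06 w06] := tight 0%N 6%N isT isT isT (a 0%N isT) (a 6%N isT).
have [y01 w01] := tight 0%N 1%N isT isT isT (a 0%N isT) (a 1%N isT).
have [y02 w02] := tight 0%N 2%N isT isT isT (a 0%N isT) (a 2%N isT).
have [y03 w03] := tight 0%N 3%N isT isT isT (a 0%N isT) (a 3%N isT).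
have [y24 w24] := tight 2%N 4%N isT isT isT (a 2%N isT) (a 4%N isT).
have [y35 w35] := tight 3%N 5%N isT isT isT (a 3%N isT) (a 5%N isT).
by case: p lp {act} => [|[|[|[|[|[|[|[|[|//]]]]]]]]] // _; lra.
Qed.

(** Outside the active set the fractional vertices induce a bipartite graph, to which
    [extreme_bicolored_integral] applies: a solved gadget has an integral triangle vertex, and in an
    unsolved one with the hub fixed to 1 the rest of the tree is cut off from the triangle. *)
Lemma extreme_frac_active f x : extreme gadgets f x ->
  forall u, frac x u -> active f u.
Proof.
move=> ex u; have [g [p [lp ->]]] := vxP u; rewrite activeE //.
have /lp_feasibleE/(_ g) fx := ex.1.
apply: contraLR; rewrite negb_and negbK => sol.
pose S := [pred u | (gad u == g) && (solved f g || (pos u < 6)%N)].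
(* Vertices 6 and 7 get opposite colours. Vertex 8 is coloured against 6 if 6 is fractional and
   against 7 otherwise; in a solved gadget the three are never all fractional, so no conflict
   arises. *)
pose col := [pred u : 'I_(nvert k) |
  if pos u == 8%N :> nat then frac x (vx g 6) else (pos u : nat) \in [:: 0; 4; 5; 7]%N].
apply: (extreme_bicolored_integral (S := S) (col := col) ex) => //; last first.
- rewrite /S /= gad_vx pos_vx // eqxx /=; case: (solved f g) sol => //=.
  by rewrite negb_or -ltnNge => /andP[].
- exact: gadgets_sym.
move=> v1 v2; have [g1 [p1 [lp1 ->]]] := vxP v1; have [g2 [p2 [lp2 ->]]] := vxP v2.
rewrite gadgetsE // /S /col /= !gad_vx !pos_vx // => /andP[/eqP <-] adj fr1 fr2.
case/andP => /eqP eg; subst g1; rewrite eqxx /=.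
have hubN : ~~ solved f g -> ~~ frac x (vx g 0).
  move=> sN; move: sol; rewrite (negbTE sN) /= negb_or => /andP[hN _].
  have [_ _ /(_ 0%N true isT)] := fx; rewrite /frac => ->; first by rewrite eqxx andbF.
  move: sN hN; rewrite /solved /hub_is !negb_or => /andP[+ _].
  by case: (f (vx g 0)) => [[]|].
case sg : (solved f g); [move=> _|move=> /= p16]; split=> //.
- move: lp1 lp2 adj fr1 fr2 (solved_tri fx sg).
  by case: p1 => [|[|[|[|[|[|[|[|[|//]]]]]]]]] _;
     case: p2 => [|[|[|[|[|[|[|[|[|//]]]]]]]]] // _ _ -> -> /=; rewrite ?andbT // => /negbTE->.
- move: lp1 lp2 adj fr1 fr2 p16.
  by case: p1 => [|[|[|[|[|[|[|[|[|//]]]]]]]]] _;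
     case: p2 => [|[|[|[|[|[|[|[|[|//]]]]]]]]] // _ _; rewrite (negbTE (hubN (negbT sg))).
- move: lp1 lp2 adj fr1 fr2 p16.
  by case: p1 => [|[|[|[|[|[|[|[|[|//]]]]]]]]] _;
     case: p2 => [|[|[|[|[|[|[|[|[|//]]]]]]]]] // _ _; rewrite (negbTE (hubN (negbT sg))).
Qed.

Lemma active_sample f u : reachable f -> frac (sample f) u = active f u.
Proof. by move=> rf; have [g [p [lp ->]]] := vxP u; apply: frac_sample. Qed.

Lemma sample_solver_output f : reachable f -> solver_output gadgets f (sample f).
Proof.
move=> rf; split; first exact: sample_optimal; split; first exact: sample_extreme.
move=> y _ ey; apply/subset_leq_card/subsetP => u; rewrite !inE active_sample //.
exact: extreme_frac_active.
Qed.

(** Every extreme point has its support inside the active set, and the sample fills that set. The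
    maximal number of fractional components therefore forces equality, so all admissible reports
    have the same support. *)
Lemma solver_output_frac f x : reachable f -> solver_output gadgets f x ->
  forall u, frac x u = active f u.
Proof.
move=> rf [ox [ex mx]] u.
have sub : [pred i | frac x i] \subset [pred i | frac (sample f) i].
  apply/subsetP => i; rewrite !inE active_sample //; exact: extreme_frac_active.
have := mx _ (sample_optimal rf) (sample_extreme rf).
rewrite /nfrac => le; have := subset_cardP _ sub => /(_ _)/(_ u).
rewrite !inE active_sample //; apply; apply/eqP.
by rewrite eqn_leq le subset_leq_card.
Qed.

End GadgetUnion.

(** * Branch-and-bound runs with a leaf count that is additive under branching *)

Lemma bb_reach_preserves (rule : branching_rule) (n : nat) (E : rel 'I_n) (P : bb_state n -> Prop) :
  (forall s t, P s -> bb_step rule E s t -> P t) ->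
  forall s t, bb_reach rule E s t -> P s -> P t.
Proof.
move=> stepP s t; elim=> // s1 s2 s3 st _ IH P1.
by apply: IH; apply: stepP st.
Qed.

Section UniformTree.
Variables (rule : branching_rule) (n : nat) (E : rel 'I_n).
Variables (inv : fixing n -> Prop) (val : fixing n -> R) (opt : R).
(* [leaves f] is the number of leaves of the subtree below the node [f]. *)
Variable leaves : fixing n -> nat.
Hypothesis valP : forall f, inv f -> lp_val E f (Some (val f)).
Hypothesis val_le : forall f, inv f -> val f <= opt.
Hypothesis leaves_gt0 : forall f, inv f -> (0 < leaves f)%N.
Hypothesis val_leaf : forall f, inv f -> leaves f = 1%N -> val f = opt.
Hypothesis solver_ex : forall f, inv f -> exists x, solver_output E f x.
Hypothesis integralP : forall f x, inv f -> solver_output E f x ->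
  integral x <-> leaves f = 1%N.
Hypothesis ruleP : forall f x j, inv f -> solver_output E f x -> @rule n E f x j ->
  (forall b, inv (setfix f j b)) /\
  (leaves (setfix f j false) + leaves (setfix f j true))%N = leaves f.
Hypothesis rule_ex : forall f x, inv f -> solver_output E f x -> ~ integral x ->
  exists j, @rule n E f x j.

(** An open node stands for a subtree of [2 * leaves f - 1] nodes, of which the node itself is
    already counted. Hence [c] is the final size: [cnt] plus the sum of [2 * leaves f - 2] over open
    nodes, written without subtraction. *)
Definition run_inv (c : nat) (s : bb_state n) : Prop :=
  let: (open, inc, cnt) := s in
  [/\ forall f, List.In f open -> inv f,
      inc = None \/ inc = Some opt &
      (cnt + (\sum_(f <- open) leaves f).*2)%N = (c + (size open).*2)%N].

Lemma val_eq f z : inv f -> lp_val E f (Some z) -> z = val f.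
Proof. by move=> If vz; have [] := lp_val_uniq vz (valP If). Qed.

(** An incumbent has value [opt], which no node value exceeds, whereas pruning by bound needs a
    strictly larger one. *)
Lemma no_prune_by_bound f inc : inv f -> inc = None \/ inc = Some opt ->
  ~ ext_lt inc (Some (val f)).
Proof.
move=> If [->|->] [] //= le ne; apply: ne; congr Some; apply/le_anti.
by rewrite le val_le.
Qed.

Lemma In_mid (T : Type) (a b : T) pre post :
  List.In b (pre ++ a :: post) <-> a = b \/ List.In b (pre ++ post).
Proof.
by rewrite !List.in_app_iff /=; split; [move=> [?|[?|?]]|move=> [?|[?|?]]]; auto.
Qed.

(** Pruning by infeasibility or bound cannot happen. Removing an integral node, of weight 1, lowers
    both sides of the count by 2; branching keeps the sum of leaves and raises both sides by 2. *)
Lemma run_inv_step c s t : run_inv c s -> bb_step rule E s t -> run_inv c t.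
Proof.
move=> I st; case: st I => [pre f post inc cnt _ nf|pre f post inc cnt z x vz _ so ix
  |pre f post inc cnt z x vz _ so nx lt|pre f post inc cnt z x j vz _ so nx nlt rj] [In Iinc sz];
  have If : inv f by apply/In/In_mid; left.
all: have In' g : List.In g (pre ++ post) -> inv g by move=> h; apply/In/In_mid; right.
- by have := lp_val_uniq nf (valP If).
- have l1 : leaves f = 1%N by apply/(integralP If so).
  split=> //.
    right; rewrite (val_eq If vz) val_leaf //.
    by case: Iinc => -> //=; rewrite minxx.
  by move: sz; rewrite !big_cat !size_cat /= big_cons l1; lia.
- by case: (no_prune_by_bound If Iinc); rewrite -(val_eq If vz).
- have [Ij lj] := ruleP If so rj; split=> //.
    by move=> g /= [<-|[<-|]] //; apply: In'.
  by move: sz; rewrite !big_cons !big_cat /= !size_cat /= big_cons -lj; lia.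
Qed.

(** Provides a node that worst-bound selection may process. *)
Lemma exists_min_val (open : seq (fixing n)) : open <> [::] ->
  exists pre f post, open = pre ++ f :: post /\
    forall g, List.In g (pre ++ post) -> val f <= val g.
Proof.
elim: open => [//|f [|g s] IH] _; first by exists [::], f, [::]; split.
have [//|pre [h [post [e hm]]]] := IH; have [le|lt] := leP (val f) (val h).
  exists [::], f, (g :: s); split=> // i; rewrite /= -/(List.In i (g :: s)) e.
  by move/In_mid => [<-//|/hm]; apply: le_trans.
exists (f :: pre), h, post; split; first by rewrite e.
by move=> i /= [<-|/hm//]; apply: ltW.
Qed.

(** The measure is the number of nodes in the subtrees below the open nodes, [2 * leaves f - 1]
    each; processing a node lowers it by one. *)
Lemma run_terminates c s : run_inv c s -> exists inc t, bb_reach rule E s ([::], inc, t).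
Proof.
case: s => [[open inc] cnt].
have [m] := ubnP (\sum_(f <- open) (leaves f).*2.-1)%N.
elim: m open inc cnt => // m IH open inc cnt ltm I.
have [->|/exists_min_val] : open = [::] \/ open <> [::] by case: (open); [left|right].
  by exists inc, cnt; constructor.
move=> [pre [f [post [e fm]]]]; subst open; case: (I) => In Iinc sz.
have If : inv f by apply/In/In_mid; left.
have vf := valP If; have [x so] := solver_ex If.
have minP g v : List.In g (pre ++ post) -> lp_val E g v -> ext_le (Some (val f)) v.
  move=> hg vg; have Ig : inv g by apply/In/In_mid; right.
  by rewrite (lp_val_uniq vg (valP Ig)); apply: fm.
have lf := leaves_gt0 If.
have next t : bb_step rule E (pre ++ f :: post, inc, cnt) t ->
    (\sum_(g <- t.1.1) (leaves g).*2.-1 < m)%N ->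
    exists inc' t', bb_reach rule E (pre ++ f :: post, inc, cnt) ([::], inc', t').
  move=> st; have := run_inv_step I st; case: t st => [[o i] cn] st It lt.
  have [inc' [t' r]] := IH o i cn lt It.
  by exists inc', t'; apply: bb_trans st r.
move: ltm; rewrite big_cat big_cons /= => ltm.
have [l1|l1] := eqVneq (leaves f) 1%N.
  have ix : integral x by apply/(integralP If so).
  by apply: next (bb_prune_integral _ _ _ vf minP so ix) _; rewrite big_cat /=; lia.
have nx : ~ integral x by move/(integralP If so) => h; rewrite h in l1.
have [j rj] := rule_ex If so nx; have [Ij lj] := ruleP If so rj.
have l0 := leaves_gt0 (Ij false); have l0' := leaves_gt0 (Ij true).
apply: next (bb_branch _ vf minP so nx (no_prune_by_bound If Iinc) rj) _.
by rewrite /= !big_cons big_cat /=; lia.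
Qed.

Hypothesis inv_root : inv (@root_fix n).

Lemma run_inv_root : run_inv (leaves (@root_fix n)).*2.-1 ([:: @root_fix n], None, 1%N).
Proof.
split=> [f [<-|//]//||]; first by left.
by have := leaves_gt0 inv_root; rewrite big_seq1 /=; lia.
Qed.

Lemma uniform_tree_exists : exists t, bb_tree_size rule E t.
Proof. by have [inc [t r]] := run_terminates run_inv_root; exists t, inc. Qed.

Lemma uniform_tree_size t : bb_tree_size rule E t -> t = (leaves (@root_fix n)).*2.-1.
Proof.
move=> [inc r].
have [_ _] := bb_reach_preserves (@run_inv_step _) r run_inv_root.
by rewrite big_nil /=; lia.
Qed.
End UniformTree.

(** * Effect of fixings, and trees on unions of gadgets *)

Section GadgetTrees.
Variable k : nat.
Implicit Types (f : fixing (nvert k)) (x : 'I_(nvert k) -> R) (g h : 'I_k).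

Lemma setfix_vx f g p b h q : (p < 9)%N -> (q < 9)%N ->
  setfix f (vx g p) b (vx h q) = if (h == g) && (q == p) then Some b else f (vx h q).
Proof. by move=> lp lq; rewrite /setfix vx_eq. Qed.

Definition agree_at f f' g := forall p, (p < 9)%N -> f (vx g p) = f' (vx g p).

Lemma setfix_agree f g p b h : (p < 9)%N -> h != g ->
  agree_at (setfix f (vx g p) b) f h.
Proof. by move=> lp hg q lq; rewrite setfix_vx // (negbTE hg). Qed.

Lemma agree_solved f f' g : agree_at f f' g -> solved f g = solved f' g.
Proof. by move=> e; rewrite /solved /hub_is /tri_free !e. Qed.

Lemma agree_reachable f f' g : agree_at f f' g -> reachable_at f g = reachable_at f' g.
Proof. by move=> e; rewrite /reachable_at /= !e. Qed.

Lemma setfix_reachable f g p b : (p < 9)%N -> reachable f ->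
  reachable_at (setfix f (vx g p) b) g -> reachable (setfix f (vx g p) b).
Proof.
move=> lp rf rg h; have [->//|hg] := eqVneq h g.
by rewrite (agree_reachable (setfix_agree f b lp hg)).
Qed.

Lemma fix_hub f g b : reachable f -> ~~ solved f g ->
  reachable (setfix f (vx g 0) b) /\ solved (setfix f (vx g 0) b) g = ~~ b.
Proof.
move=> rf; rewrite solvedN => /and4P[_ /eqP t6 /eqP t7 /eqP t8]; split.
  apply: setfix_reachable => //; have /andP[lf _] := rf g; move: lf.
  by rewrite /reachable_at /= !setfix_vx // eqxx /= t6 t7 t8 /reachable_vals => ->; case: (b).
by rewrite /solved /hub_is /tri_free !setfix_vx // eqxx /= t6 t7 t8 orbF; case: (b).
Qed.

Lemma fix_tri f g p b : (6 <= p < 9)%N -> reachable f -> ~~ solved f g ->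
  reachable (setfix f (vx g p) b) /\ solved (setfix f (vx g p) b) g.
Proof.
move=> /andP[p6 lp] rf; rewrite solvedN => /and4P[h0 /eqP t6 /eqP t7 /eqP t8]; split.
  apply: setfix_reachable => //; have /andP[lf _] := rf g; move: lf h0.
  rewrite /reachable_at /= !setfix_vx // eqxx /= t6 t7 t8 /reachable_vals.
  by case: p p6 lp => [|[|[|[|[|[|[|[|[|//]]]]]]]]] // _ _ /= -> ->.
rewrite /solved /hub_is /tri_free !setfix_vx // eqxx /= t6 t7 t8.
by case: p p6 lp => [|[|[|[|[|[|[|[|[|//]]]]]]]]] // _ _; rewrite orbT.
Qed.

Lemma node_val_setfix f g p b : (p < 9)%N ->
  node_val (setfix f (vx g p) b) = node_val f + (gval (setfix f (vx g p) b) g - gval f g).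
Proof.
move=> lp; rewrite /node_val (bigD1 g) //= [in RHS](bigD1 g) //=.
rewrite (eq_bigr (gval f)); first by lra.
by move=> h hg; rewrite /gval (agree_solved (setfix_agree f b lp hg)).
Qed.

(** The IP value, as [gadgets_ip_val] shows. *)
Definition opt_val : R := (5 * k%:R)%R.

Lemma node_val_le f : node_val f <= opt_val.
Proof.
have -> : opt_val = \sum_(g < k) 5 by rewrite sumr_const card_ord /opt_val mulr_natr.
by apply: ler_sum => g _; rewrite /gval; case: ifP => _; lra.
Qed.

Lemma node_val_solved f : (forall g, solved f g) -> node_val f = opt_val.
Proof.
move=> sf; rewrite /node_val (eq_bigr (fun=> 5)); last by move=> g _; rewrite /gval sf.
by rewrite sumr_const card_ord /opt_val mulr_natr.
Qed.

Lemma solver_output_obj f x : reachable f -> solver_output (@gadgets k) f x -> obj x = node_val f.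
Proof.
move=> rf [[fx ox] _]; apply/le_anti; rewrite obj_ge_node_val // andbT.
by rewrite -obj_sample //; apply/ox/sample_feasible.
Qed.

Lemma solver_output_integral f x : reachable f -> solver_output (@gadgets k) f x ->
  integral x <-> forall g, solved f g.
Proof.
move=> rf so; split=> [ix g|sf u].
  apply/negPn/negP => us; have := solver_output_frac rf so (vx g 6).
  rewrite activeE // us orbT /frac.
  by case: (ix (vx g 6)) => ->; rewrite eqxx ?andbF.
have := solver_output_frac rf so u; rewrite /active sf /= /frac.
move/negbT; rewrite negb_and !negbK.
by case/orP => /eqP; [left|right].
Qed.

Lemma not_integral_unsolved f x : reachable f -> solver_output (@gadgets k) f x -> ~ integral x ->
  exists g, ~~ solved f g.
Proof.
move=> rf so nx; apply/existsP; apply: contraT.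
rewrite negb_exists => /forallP sf; case: nx.
by apply/(solver_output_integral rf so) => g; have := sf g; rewrite negbK.
Qed.

Section WeightedTree.
Variables (rule : branching_rule) (w : fixing (nvert k) -> 'I_k -> nat).
Hypothesis w_agree : forall f f' g, agree_at f f' g -> w f g = w f' g.
Hypothesis w_gt0 : forall f g, (0 < w f g)%N.
Hypothesis w_solved : forall f g, (w f g == 1%N) = solved f g.
Hypothesis w_rule : forall f x j, reachable f -> solver_output (@gadgets k) f x ->
  @rule _ (@gadgets k) f x j -> exists g p,
  [/\ j = vx g p, (p < 9)%N, forall b, reachable (setfix f j b) &
      (w (setfix f j false) g + w (setfix f j true) g)%N = w f g].
Hypothesis w_rule_ex : forall f x, reachable f -> solver_output (@gadgets k) f x -> ~ integral x ->
  exists j, @rule _ (@gadgets k) f x j.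

(** Gadgets are solved independently of each other, so their leaf counts [w] multiply. A branching
    alters one factor, and the two children's values of that factor add up to the old one. *)
Definition leaves f : nat := (\prod_g w f g)%N.

Lemma leaves_eq1 f : leaves f = 1%N <-> forall g, solved f g.
Proof.
split=> [e g|sf].
  rewrite -w_solved -dvdn1 -e /leaves (bigD1 g) //=; exact: dvdn_mulr.
by apply: big1 => g _; apply/eqP; rewrite w_solved.
Qed.

Lemma leaves_setfix f g p : (p < 9)%N ->
  (w (setfix f (vx g p) false) g + w (setfix f (vx g p) true) g)%N = w f g ->
  (leaves (setfix f (vx g p) false) + leaves (setfix f (vx g p) true))%N = leaves f.
Proof.
move=> lp e; rewrite /leaves (bigD1 g) //= [X in (_ + X)%N](bigD1 g) //= [RHS](bigD1 g) //=.
rewrite -e mulnDl; congr addn; congr muln; apply: eq_bigr => h hg;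
  exact/w_agree/setfix_agree.
Qed.

Lemma reachable_root : reachable (@root_fix (nvert k)).
Proof. by move=> g. Qed.

Let val_leaf f : reachable f -> leaves f = 1%N -> node_val f = opt_val.
Proof. by move=> _ /leaves_eq1; apply: node_val_solved. Qed.

Let integralP f x : reachable f -> solver_output (@gadgets k) f x -> integral x <-> leaves f = 1%N.
Proof.
by move=> rf so; split=> [/(solver_output_integral rf so)/leaves_eq1|/leaves_eq1]; last
  move/(solver_output_integral rf so).
Qed.

Let ruleP f x j : reachable f -> solver_output (@gadgets k) f x -> @rule _ (@gadgets k) f x j ->
  (forall b, reachable (setfix f j b)) /\
  (leaves (setfix f j false) + leaves (setfix f j true))%N = leaves f.
Proof.
move=> rf so /(w_rule rf so) [g [p [-> lp rj e]]]; split=> //; exact: leaves_setfix.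
Qed.

Lemma gadget_tree_exists : exists t, bb_tree_size rule (@gadgets k) t.
Proof.
apply: (uniform_tree_exists (val := @node_val k) (leaves := leaves)
  _ _ _ val_leaf _ integralP ruleP w_rule_ex reachable_root).
- exact: node_valP.
- by move=> f _; apply: node_val_le.
- by move=> f _; apply: prodn_gt0.
- by move=> f rf; exists (sample f); apply: sample_solver_output.
Qed.

Lemma gadget_tree_size t :
  bb_tree_size rule (@gadgets k) t -> t = (leaves (@root_fix (nvert k))).*2.-1.
Proof.
apply: (uniform_tree_size (val := @node_val k) (leaves := leaves)
  _ _ _ val_leaf integralP ruleP reachable_root).
- exact: node_valP.
- by move=> f _; apply: node_val_le.
- by move=> f _; apply: prodn_gt0.
Qed.

End WeightedTree.
End GadgetTrees.

(** * The greedy tree *)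

Section GreedyTree.
Variable k : nat.
Implicit Types (f : fixing (nvert k)) (x : 'I_(nvert k) -> R) (g h : 'I_k).

Definition greedy_weight f g : nat :=
  if solved f g then 1%N else if hub_is f g None then 3%N else 2%N.

(** All nine vertices of a fresh gadget are fractional, so the greedy count there is the degree,
    which only the hub maximizes within its gadget. *)
Lemma nfrac_nbrs_fresh f x g p : reachable f -> solver_output (@gadgets k) f x ->
  ~~ solved f g -> hub_is f g None -> (p < 9)%N ->
  nfrac_nbrs (@gadgets k) x (vx g p) = count (gadget_adj p) (iota 0 9).
Proof.
move=> rf so us hN lp; rewrite /nfrac_nbrs -sum1_card big_mkcond big_vx (bigD1 g) //=.
rewrite [X in (_ + X)%N]big1 ?addn0 => [|h hg]; last first.
  by apply: big1 => q _; rewrite inE gadgetsE // eq_sym (negbTE hg).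
rewrite !big_ord_recr big_ord0 /= !inE !gadgetsE // !eqxx /=.
rewrite !(solver_output_frac rf so) !activeE // us hN /= !andbT.
by do 9![case: gadget_adj].
Qed.

Lemma greedy_weight_rule f x j : reachable f -> solver_output (@gadgets k) f x ->
  greedy_rule (@gadgets k) f x j -> exists g p,
  [/\ j = vx g p, (p < 9)%N, forall b, reachable (setfix f j b) &
      (greedy_weight (setfix f j false) g + greedy_weight (setfix f j true) g)%N
      = greedy_weight f g].
Proof.
move=> rf so [fj mj]; have [g [p [lp ej]]] := vxP j; subst j; exists g, p.
move: fj; rewrite (solver_output_frac rf so) activeE // => /andP[us].
rewrite /greedy_weight (negbTE us); case hN : (hub_is f g None) => /= p6.
  (* Comparing with the hub of the same gadget is enough. *)
  have p0 : p = 0%N.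
    have := mj (vx g 0); rewrite (solver_output_frac rf so) activeE // us hN => /(_ isT).
    rewrite !(nfrac_nbrs_fresh rf so us hN) //.
    by case: p lp {mj p6} => [|[|[|[|[|[|[|[|[|//]]]]]]]]].
  subst p; split=> // [b|].
    by have [] := fix_hub b rf us.
  have [_ ->] := fix_hub false rf us; have [_ ->] := fix_hub true rf us.
  by rewrite /hub_is !setfix_vx // !eqxx /=.
have p69 : (6 <= p < 9)%N by rewrite p6.
split=> // [b|]; first by have [] := fix_tri b p69 rf us.
by have [_ ->] := fix_tri false p69 rf us; have [_ ->] := fix_tri true p69 rf us.
Qed.

Lemma greedy_rule_ex f x : reachable f -> solver_output (@gadgets k) f x -> ~ integral x ->
  exists j, greedy_rule (@gadgets k) f x j.
Proof.
move=> rf so nx; have [g us] := not_integral_unsolved rf so nx.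
have f6 : frac x (vx g 6) by rewrite (solver_output_frac rf so) activeE // us orbT.
by case: (arg_maxnP (nfrac_nbrs (@gadgets k) x) f6) => j fj mj; exists j; split.
Qed.

Lemma greedy_weight_agree f f' g : agree_at f f' g -> greedy_weight f g = greedy_weight f' g.
Proof. by move=> e; rewrite /greedy_weight (agree_solved e) /hub_is e. Qed.

Lemma greedy_weight_gt0 f g : (0 < greedy_weight f g)%N.
Proof. by rewrite /greedy_weight; do 2?case: ifP. Qed.

Lemma greedy_weight_eq1 f g : (greedy_weight f g == 1%N) = solved f g.
Proof. by rewrite /greedy_weight; do 2?case: ifP. Qed.

Lemma greedy_tree_exists : exists t, bb_tree_size greedy_rule (@gadgets k) t.
Proof.
exact: gadget_tree_exists greedy_weight_agree greedy_weight_gt0 greedy_weight_eq1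
  greedy_weight_rule greedy_rule_ex.
Qed.

Lemma greedy_tree_size t : bb_tree_size greedy_rule (@gadgets k) t -> t = (3 ^ k).*2.-1.
Proof.
move/(gadget_tree_size greedy_weight_agree greedy_weight_gt0 greedy_weight_eq1
  greedy_weight_rule) => ->.
rewrite /leaves (eq_bigr (fun=> 3%N)); last by move=> g _.
by rewrite prod_nat_const card_ord.
Qed.

End GreedyTree.

(** * The strong-branching tree *)

Section StrongTree.
Variable k : nat.
Implicit Types (f : fixing (nvert k)) (x : 'I_(nvert k) -> R) (g h : 'I_k).

Definition strong_weight f g : nat := if solved f g then 1%N else 2%N.

(** Both fixings solve the gadget and gain 1/2. The score is a relation, so the equivalence is
    needed: one direction computes it, the other exhibits it. *)
Lemma score_tri f g p s : (6 <= p < 9)%N -> reachable f -> ~~ solved f g ->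
  sb_score (@gadgets k) f (node_val f) (vx g p) s <-> s = Some (1 / 2 * (1 / 2))%R.
Proof.
move=> p69 rf us; have lp : (p < 9)%N by case/andP: p69.
have vb b : lp_val (@gadgets k) (setfix f (vx g p) b) (Some (node_val f + 1 / 2)%R).
  have [rb sb] := fix_tri b p69 rf us.
  have -> : (node_val f + 1 / 2)%R = node_val (setfix f (vx g p) b).
    by rewrite node_val_setfix // /gval sb (negbTE us); lra.
  exact: node_valP.
have e : (node_val f + 1 / 2 - node_val f)%R = (1 / 2)%R by lra.
split=> [[v0 [v1 [h0 [h1 ->]]]]|->].
  by rewrite (lp_val_uniq h0 (vb false)) (lp_val_uniq h1 (vb true)) /= e.
exists (Some (node_val f + 1 / 2)%R), (Some (node_val f + 1 / 2)%R).
by split; [exact: vb|split; [exact: vb|rewrite /= e]].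
Qed.

(* Covering the bipartite part of a fresh gadget by {0, 4, 5} costs nothing. *)
Lemma free_child f g p : (p < 6)%N -> reachable f -> ~~ solved f g -> hub_is f g None ->
  lp_val (@gadgets k) (setfix f (vx g p) (p \in [:: 0; 4; 5]%N)) (Some (node_val f)).
Proof.
move=> p6 rf us hN; have lp : (p < 9)%N by apply: leq_trans p6 _.
have [r1 s1] := fix_hub true rf us.
pose f1 := setfix f (vx g 0) true; rewrite -/f1 in r1.
have fp : f (vx g p) = None.
  have /andP[/and5P[/eqP f1' /eqP f2 /eqP f3 /eqP f4 /andP[/eqP f5 _]] _] := rf g.
  by move: p6 {lp}; case: p => [|[|[|[|[|[|//]]]]]] // _; apply/eqP.
have sf := sample_feasible r1.
split; last first.
  move=> y [y01 [yE yf]]; apply: obj_ge_node_val; split=> //; split=> // u b fu.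
  by apply: yf; rewrite /setfix; case: eqP => // e; rewrite e fp in fu.
(* The sample for the hub fixed to 1 has value 1 on 0, 4, 5 and 0 on 1, 2, 3, so this single
   solution serves all six positions; the gadget stays unsolved, hence the value is unchanged. *)
exists (sample f1); split; last first.
  by rewrite obj_sample // /f1 node_val_setfix // /gval s1 (negbTE us) /=; lra.
have [x01 [xE xf]] := sf; split=> //; split=> // u b; rewrite /setfix.
case: eqP => [-> [<-]|_ fu]; last first.
  apply: xf; rewrite /f1 /setfix; case: eqP => // e.
  by move: hN; rewrite /hub_is -e fu.
have sa : sample_at f1 g = [:: 2; 0; 0; 0; 2; 2; 1; 1; 1]%N.
  move: us; rewrite solvedN => /and4P[_ /eqP t6 /eqP t7 /eqP t8].
  by rewrite /sample_at /f1 !setfix_vx // !eqxx /= t6 t7 t8.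
rewrite sampleE // sa.
by case: p p6 {lp fp} => [|[|[|[|[|[|//]]]]]] // _ /=; rewrite ?mul0r ?divff // pnatr_eq0.
Qed.

(** One child gains nothing by [free_child], and the convention 0 * oo = 0 annihilates the product
    even if the other child is infeasible. *)
Lemma score_free f g p s : (p < 6)%N -> reachable f -> ~~ solved f g -> hub_is f g None ->
  sb_score (@gadgets k) f (node_val f) (vx g p) s -> s = Some 0%R.
Proof.
move=> p6 rf us hN [v0 [v1 [h0 [h1 ->]]]]; have := free_child p6 rf us hN.
case: (p \in _) => h.
  rewrite (lp_val_uniq h1 h) /= subrr; case: (v0) => [a|] /=; last by rewrite eqxx.
  by rewrite mulr0.
rewrite (lp_val_uniq h0 h) /= subrr; case: (v1) => [a|] /=; last by rewrite eqxx.
by rewrite mul0r.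
Qed.

Lemma strong_weight_rule f x j : reachable f -> solver_output (@gadgets k) f x ->
  strong_branching (@gadgets k) f x j -> exists g p,
  [/\ j = vx g p, (p < 9)%N, forall b, reachable (setfix f j b) &
      (strong_weight (setfix f j false) g + strong_weight (setfix f j true) g)%N
      = strong_weight f g].
Proof.
move=> rf so [fj [sj [hj mj]]]; have [g [p [lp ej]]] := vxP j; subst j; exists g, p.
rewrite (solver_output_obj rf so) in hj mj.
move: fj; rewrite (solver_output_frac rf so) activeE // => /andP[us hub].
have p6 : (6 <= p)%N.
  case: (ltnP p 6) hub => // p6; rewrite orbF => hN.
  (* Vertex 6 of the same gadget scores 1/4, beating the score 0 of a tree vertex. *)
  have := mj (vx g 6) _ _ (proj2 (score_tri _ (isT : (6 <= 6 < 9)%N) rf us) erefl).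
  rewrite (solver_output_frac rf so) activeE // us orbT => /(_ isT).
  by rewrite (score_free p6 rf us hN hj) /= => ?; lra.
have p69 : (6 <= p < 9)%N by rewrite p6.
rewrite /strong_weight (negbTE us).
split=> // [b|]; first by have [] := fix_tri b p69 rf us.
by have [_ ->] := fix_tri false p69 rf us; have [_ ->] := fix_tri true p69 rf us.
Qed.

Lemma strong_branching_ex f x : reachable f -> solver_output (@gadgets k) f x -> ~ integral x ->
  exists j, strong_branching (@gadgets k) f x j.
Proof.
move=> rf so nx; have [g us] := not_integral_unsolved rf so nx.
exists (vx g 6); split; first by rewrite (solver_output_frac rf so) activeE // us orbT.
(* This is the largest score overall: a fractional vertex of any gadget scores 1/4 in a triangle and
   0 in a tree. *)
exists (Some (1 / 2 * (1 / 2))%R); rewrite (solver_output_obj rf so).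
split; first by apply/(score_tri _ (isT : (6 <= 6 < 9)%N) rf us).
move=> j s; have [h [q [lq ->]]] := vxP j.
rewrite (solver_output_frac rf so) activeE // => /andP[us' hub].
case: (ltnP q 6) hub => q6.
  by rewrite orbF => hN /(score_free q6 rf us' hN) -> /=; lra.
have q69 : (6 <= q < 9)%N by rewrite q6.
by move=> _ /(score_tri _ q69 rf us') ->; rewrite /=.
Qed.

Lemma strong_weight_agree f f' g : agree_at f f' g -> strong_weight f g = strong_weight f' g.
Proof. by move=> e; rewrite /strong_weight (agree_solved e). Qed.

Lemma strong_weight_gt0 f g : (0 < strong_weight f g)%N.
Proof. by rewrite /strong_weight; case: ifP. Qed.

Lemma strong_weight_eq1 f g : (strong_weight f g == 1%N) = solved f g.
Proof. by rewrite /strong_weight; case: ifP. Qed.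

Lemma strong_tree_exists : exists t, bb_tree_size strong_branching (@gadgets k) t.
Proof.
exact: gadget_tree_exists strong_weight_agree strong_weight_gt0 strong_weight_eq1
  strong_weight_rule strong_branching_ex.
Qed.

Lemma strong_tree_size t :
  bb_tree_size strong_branching (@gadgets k) t -> t = (2 ^ k).*2.-1.
Proof.
move/(gadget_tree_size strong_weight_agree strong_weight_gt0 strong_weight_eq1
  strong_weight_rule) => ->.
rewrite /leaves (eq_bigr (fun=> 2%N)); last by move=> g _.
by rewrite prod_nat_const card_ord.
Qed.

End StrongTree.

(** * The IP value, the gap and the final estimates *)

Lemma gadgets_ip_val k : ip_val (@gadgets k) (opt_val k).
Proof.
(* Fixing every hub to 0 solves all gadgets, so the sample at this node is an integral cover with
   five vertices per gadget. *)
pose f0 : fixing (nvert k) := fun u => if pos u == 0%N :> nat then Some false else None.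
have e0 (g : 'I_k) p : (p < 9)%N -> f0 (vx g p) = if p == 0%N then Some false else None.
  by move=> lp; rewrite /f0 pos_vx.
have r0 : reachable f0 by move=> g; rewrite /reachable_at /= !e0.
have s0 g : solved f0 g by rewrite /solved /hub_is e0.
split.
  exists (sample f0); split; last split.
  - by have [x01 [xE _]] := sample_feasible r0; split=> //; split.
  - by apply/(solver_output_integral r0 (sample_solver_output r0)).
  - by rewrite obj_sample // node_val_solved.
move=> x /lp_feasibleE fx ix; rewrite objE -(node_val_solved s0) /node_val.
apply: ler_sum => g _; rewrite /gval s0; apply: gsum_ge_tri (fx g) _.
by rewrite {1}/frac; case: (ix (vx g 6)) => ->; rewrite eqxx ?andbF.
Qed.

Lemma gadgets_gap k : gap (@gadgets k) (k%:R / 2)%R.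
Proof.
exists (opt_val k), (node_val (@root_fix (nvert k))); split; first exact: gadgets_ip_val.
split; first exact/node_valP/reachable_root.
rewrite /node_val (eq_bigr (fun=> 9 / 2)) => [|g _].
  by rewrite sumr_const card_ord -mulr_natr /opt_val; lra.
by rewrite /gval /solved.
Qed.

(** Both exponents in the theorem are half-integers, so real powers of 2 reduce to natural powers of
    [sqrt 2]. *)
Lemma Rpower2_half (a : R) (m : nat) : a = m%:R / 2 -> Rpower 2 a = sqrt 2 ^+ m.
Proof.
move=> ->; have IZR2 : IZR 2 = 2%:R by rewrite IZRposE INRE.
have two_gt0 : Rlt 0 2 by apply: IZR_lt.
have -> : m%:R / 2 = Rmult (Rinv 2) (INR m) by rewrite INRE RmultE RinvE IZR2 mulrC.
rewrite -Rpower_mult Rpower_sqrt // Rpower_pow ?RpowE //; exact: sqrt_lt_R0.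
Qed.

Lemma sqrt2_sqr : sqrt 2 ^+ 2 = 2.
Proof.
have two_ge0 : Rle 0 2 by apply: IZR_le.
by rewrite expr2 -RmultE sqrt_sqrt // IZRposE INRE.
Qed.

(** The upper bound gives [2 * sqrt 2 <= 3], on which both final estimates rest. *)
Lemma sqrt2_bounds : 1 <= sqrt 2 <= 3 / 2.
Proof.
have s0 : 0 <= sqrt 2 by apply/RleP/sqrt_pos.
by have := sqrt2_sqr => s2; apply/andP; split; nra.
Qed.

Lemma nvertE k : nvert k = (k * 9)%N.
Proof. by rewrite /nvert card_prod !card_ord. Qed.

Lemma natr_double_pred (m : nat) : (0 < m)%N -> (m.*2.-1)%:R = 2 * m%:R - 1 :> R.
Proof.
move=> m0; have e : (m.*2.-1).+1 = (2 * m)%N by lia.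
by rewrite -natrM -e -natr1 addrK.
Qed.

Theorem theorem2p4 :
  exists c d : R, 2 < c /\ 0 < d /\
  forall N : nat, exists n : nat, (N <= n)%N /\
  exists E : rel 'I_n, simple_graph E /\
    (exists tS, bb_tree_size strong_branching E tS) /\
    (exists tG, bb_tree_size greedy_rule E tG) /\
    exists g, gap E g /\
    forall tS tG : nat,
      bb_tree_size strong_branching E tS -> bb_tree_size greedy_rule E tG ->
      Rpower 2 (d * n%:R) * tS%:R <= tG%:R /\ Rpower 2 (c * g) <= tG%:R.
Proof.
(* With [n = 9 * k] and gap [k / 2], these constants give the exponents [k / 2] and [3 * k / 2],
   that is, the [k]-th and [3 * k]-th powers of [sqrt 2]. *)
exists (3%:R)%R, (1 / 18)%R; split; first by lra.
split; first by lra.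
(* The given bound itself serves as the number of gadgets. *)
move=> k; exists (nvert k); split; first by rewrite nvertE; lia.
exists (@gadgets k); split; first exact: gadgets_simple.
split; first exact: strong_tree_exists.
split; first exact: greedy_tree_exists.
exists (k%:R / 2)%R; split; first exact: gadgets_gap.
move=> tS tG /strong_tree_size -> /greedy_tree_size ->.
rewrite (@Rpower2_half _ k); last by rewrite RmultE nvertE natrM; lra.
rewrite (@Rpower2_half _ (3 * k)); last by rewrite RmultE natrM; lra.
rewrite !natr_double_pred ?expn_gt0 // !natrX exprM.
have /andP[s1 s32] := sqrt2_bounds; have s2 := sqrt2_sqr.
have sk1 : 1 <= sqrt 2 ^+ k by apply: exprn_ege1.
have t1 : 1 <= 3 ^+ k :> R by apply: exprn_ege1; lra.
have le3 a : 0 <= a -> a <= 3 -> a ^+ k <= 3 ^+ k :> R.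
  by move=> a0 a3; apply: lerXn2r; rewrite ?nnegrE; lra.
split.
  (* Multiplying [2 * 2 ^ k - 1] by [sqrt 2 ^ k] turns its first term into [2 * (2 * sqrt 2) ^ k]
     and subtracts at least 1. *)
  have : (sqrt 2 * 2) ^+ k <= 3 ^+ k by apply: le3; lra.
  by rewrite exprMn => ?; lra.
(* As [3 ^ k] is at least 1, a bound by [3 ^ k] already gives one by [2 * 3 ^ k - 1]. *)
have : (sqrt 2 ^+ 3) ^+ k <= 3 ^+ k by apply: le3; rewrite exprS s2; lra.
by move=> ?; lra.
Qed.
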